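(* Let $\rho_{AB}\in B(\mathcal{H}_A^N\otimes\mathcal{H}_B^M)$ be a state that is not symmetrically extendible (with respect to $B$). Then there does not exist any state $\rho_{A'B'}\in B(\mathcal{H}_{A'}^K\otimes\mathcal{H}_{B'}^L)$ such that $\rho_{AB}\otimes\rho_{A'B'}$, regarded as a bipartite state of $AA'$ versus $BB'$, is symmetrically extendible with respect to the subsystem $BB'$.
   Context: All Hilbert spaces are finite-dimensional; superscripts $N,M,K,L$ denote dimensions. A state is a positive semidefinite operator of trace one. A bipartite state $\rho_{XY}\in B(\mathcal{H}_X\otimes\mathcal{H}_Y)$ is symmetrically extendible with respect to $Y$ if there is a state $\rho_{XYE}\in B(\mathcal{H}_X\otimes\mathcal{H}_Y\otimes\mathcal{H}_E)$ with $\mathcal{H}_E\cong\mathcal{H}_Y$ that is invariant under conjugation by the operator swapping $Y$ and $E$ and satisfies $\mathrm{Tr}_E\rho_{XYE}=\rho_{XY}$. *)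

(* Defs.v *)
From mathcomp Require Import all_boot all_order all_algebra.
From mathcomp Require Import reals.
From mathcomp Require Export complex mxtens.

Set Implicit Arguments.
Unset Strict Implicit.
Unset Printing Implicit Defensive.

Import Order.TTheory GRing.Theory Num.Theory.
Local Open Scope ring_scope.
Local Open Scope sesquilinear_scope.

(* B(H) with dim H = n is 'M[R[i]]_n, and H_1 (x) H_2 has basis vectors
   e_a (x) e_b indexed by mxtens_index (a, b), the indexing used by tensmx. *)

(* In the order of R[i], 0 <= z means that z is real and nonnegative, so psdmx A
   forces A to be Hermitian. *)
Definition psdmx (R : realType) (n : nat) (A : 'M[R[i]]_n) : Prop :=
  forall v : 'cV[R[i]]_n, 0 <= (v ^t* *m A *m v) 0 0.

Definition is_state (R : realType) (n : nat) (rho : 'M[R[i]]_n) : Prop :=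
  psdmx rho /\ \tr rho = 1.

(* Partial trace over the second tensor factor. *)
Definition ptrace2 (R : realType) (m n : nat) (X : 'M[R[i]]_(m * n)) :
    'M[R[i]]_m :=
  \matrix_(i, j) \sum_(k < n) X (mxtens_index (i, k)) (mxtens_index (j, k)).

Definition swap23_index (x y : nat) (i : 'I_(x * y * y)) : 'I_(x * y * y) :=
  let: (ab, c) := mxtens_unindex i in
  let: (a, b) := mxtens_unindex ab in
  mxtens_index (mxtens_index (a, c), b).

(* The operator e_a (x) e_b (x) e_c |-> e_a (x) e_c (x) e_b on X (x) Y (x) E. *)
Definition swap23 (R : realType) (x y : nat) : 'M[R[i]]_(x * y * y) :=
  \matrix_(i, j) (i == swap23_index j)%:R.

Definition symmetrically_extendible (R : realType) (x y : nat)
    (rho : 'M[R[i]]_(x * y)) : Prop :=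
  exists omega : 'M[R[i]]_(x * y * y),
    [/\ is_state omega,
        swap23 R x y *m omega *m (swap23 R x y) ^t* = omega
      & ptrace2 omega = rho].

(* (A A')(B B') |-> (A B)(A' B') on basis indices. *)
Definition regroup_index (n m k l : nat) (i : 'I_((n * k) * (m * l))) :
    'I_((n * m) * (k * l)) :=
  let: (aa', bb') := mxtens_unindex i in
  let: (a, a') := mxtens_unindex aa' in
  let: (b, b') := mxtens_unindex bb' in
  mxtens_index (mxtens_index (a, b), mxtens_index (a', b')).

(* The same operator on A B A' B', regarded as one on (A A') (x) (B B'). *)
Definition regroup (R : realType) (n m k l : nat)
    (X : 'M[R[i]]_((n * m) * (k * l))) : 'M[R[i]]_((n * k) * (m * l)) :=
  mxsub (@regroup_index n m k l) (@regroup_index n m k l) X.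

(* Main.v *)
(* Tracing out A', B' and E' from a symmetric extension of
   rhoAB (x) rhoA'B' yields a symmetric extension of rhoAB: the swap of BB' with
   EE' restricts to the swap of B with E, up to exchanging the traced factors
   B' and E'. *)
Require Import Defs.
From mathcomp Require Import all_boot all_order all_algebra.
From mathcomp Require Import reals.
Set Implicit Arguments.
Unset Strict Implicit.
Unset Printing Implicit Defensive.
Import Order.TTheory GRing.Theory Num.Theory.
Local Open Scope ring_scope.
Local Open Scope sesquilinear_scope.

Lemma swap23_indexE (x y : nat) (a : 'I_x) (b c : 'I_y) :
  swap23_index (mxtens_index (mxtens_index (a, b), c)) =
  mxtens_index (mxtens_index (a, c), b).
Proof. by rewrite /swap23_index !mxtens_indexK. Qed.

Lemma swap23_indexK (x y : nat) : involutive (@swap23_index x y).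
Proof.
move=> i; case: (mxtens_indexP i) => ab c; case: (mxtens_indexP ab) => a b.
by rewrite !swap23_indexE.
Qed.

Lemma regroup_indexE (n m k l : nat) (a : 'I_n) (b : 'I_m) (a' : 'I_k)
    (b' : 'I_l) :
  regroup_index
    (mxtens_index (mxtens_index (a, a'), mxtens_index (b, b'))) =
  mxtens_index (mxtens_index (a, b), mxtens_index (a', b')).
Proof. by rewrite /regroup_index !mxtens_indexK. Qed.

Lemma sum_mxtens_index (V : nmodType) (m n : nat) (F : 'I_(m * n) -> V) :
  \sum_i F i = \sum_p F (mxtens_index p).
Proof.
apply: reindex; exists (@mxtens_unindex m n) => i _.
  exact: mxtens_indexK.
exact: mxtens_unindexK.
Qed.

Section States.
Variable R : realType.

(** [swap23] is the permutation matrix of an involution, so each sum in the product keeps a single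
    term. Invariance under the swap thus becomes an identity between entries. *)
Lemma swap23_conjE (x y : nat) (A : 'M[R[i]]_(x * y * y)) :
  swap23 R x y *m A *m (swap23 R x y) ^t* =
  mxsub (@swap23_index x y) (@swap23_index x y) A.
Proof.
have swapE i j : swap23 R x y i j = (j == swap23_index i)%:R.
  by rewrite mxE -(inj_eq (inv_inj (@swap23_indexK x y))) swap23_indexK eq_sym.
apply/matrixP => i j; rewrite !mxE (bigD1 (swap23_index j)) //= big1 => [|k kj].
  rewrite !mxE swap23_indexK eqxx rmorph1 mulr1 addr0.
  rewrite (bigD1 (swap23_index i)) //= big1 => [|k ki].
    by rewrite swapE eqxx mul1r addr0.
  by rewrite swapE (negPf ki) mul0r.
by rewrite [(_ ^t*) _ _]mxE [_^T _ _]mxE swapE (negPf kj) rmorph0 mulr0.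
Qed.

Lemma mxtrace_ptrace2 (m n : nat) (A : 'M[R[i]]_(m * n)) :
  \tr (ptrace2 A) = \tr A.
Proof.
rewrite /mxtrace [RHS]sum_mxtens_index.
under eq_bigr do rewrite mxE.
by rewrite pair_bigA /=; apply: eq_bigr => -[].
Qed.

(** With [P] the matrix sending $e_j$ to $e_{f(j)}$, the quadratic form of $P^* A P$ at $v$ is that
    of $A$ at $P v$. *)
Lemma psdmx_mxsub (m n : nat) (f : 'I_m -> 'I_n) (A : 'M[R[i]]_n) :
  psdmx A -> psdmx (mxsub f f A).
Proof.
move=> psdA v; pose P : 'M[R[i]]_(n, m) := \matrix_(i, j) (i == f j)%:R.
suff -> : mxsub f f A = P ^t* *m A *m P.
  have := psdA (P *m v).
  by rewrite trmx_mul map_mxM /= !mulmxA.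
apply/matrixP => i j; rewrite !mxE (bigD1 (f j)) //= big1 => [|k kj].
  rewrite [P _ _]mxE eqxx mulr1 addr0 mxE (bigD1 (f i)) //= big1 => [|k ki].
    by rewrite !mxE eqxx rmorph1 mul1r addr0.
  by rewrite !mxE (negPf ki) rmorph0 mul0r.
by rewrite [P _ _]mxE (negPf kj) mulr0.
Qed.

Lemma psdmx_sum (I : finType) (n : nat) (F : I -> 'M[R[i]]_n) :
  (forall t, psdmx (F t)) -> psdmx (\sum_t F t).
Proof.
move=> psdF v; rewrite mulmx_sumr mulmx_suml summxE.
by apply: sumr_ge0 => t _; apply: psdF.
Qed.

Lemma symmetrically_extendible_tensl (n m k l : nat) (rho : 'M[R[i]]_(n * m))
    (sigma : 'M[R[i]]_(k * l)) :
  \tr rho = 1 -> \tr sigma = 1 ->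
  symmetrically_extendible (regroup (tensmx rho sigma)) ->
  symmetrically_extendible rho.
Proof.
move=> tr_rho tr_sigma [Omega [[psdO _] swapO ptrO]].
(* [J t] places a basis index of $ABE$ among those of $(AA')(BB')(EE')$, with the indices of $A'$,
   $B'$, $E'$ fixed to [t]. *)
pose J (t : 'I_k * 'I_l * 'I_l) (i : 'I_(n * m * m)) :
    'I_((n * k) * (m * l) * (m * l)) :=
  let: (ab, e) := mxtens_unindex i in
  let: (a, b) := mxtens_unindex ab in
  mxtens_index (mxtens_index
    (mxtens_index (a, t.1.1), mxtens_index (b, t.1.2)), mxtens_index (e, t.2)).
have JE a' b' e' a b e :
    J (a', b', e') (mxtens_index (mxtens_index (a, b), e)) =
    mxtens_index (mxtens_index
      (mxtens_index (a, a'), mxtens_index (b, b')), mxtens_index (e, e')).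
  by rewrite /J !mxtens_indexK.
pose flip (t : 'I_k * 'I_l * 'I_l) := (t.1.1, t.2, t.1.2).
have flipK : involutive flip by move=> [[]].
(* Swapping $BB'$ with $EE'$ also exchanges $b'$ and $e'$; [flip] compensates for this. *)
have J_swap t i : J t (swap23_index i) = swap23_index (J (flip t) i).
  case: t => [[a' b'] e'].
  case: (mxtens_indexP i) => ab e; case: (mxtens_indexP ab) => a b.
  by rewrite swap23_indexE !JE swap23_indexE.
(* This is the partial trace of [Omega] over $A'B'E'$, written as a sum of compressions so that
   positivity can be checked term by term. *)
pose omega := \sum_t mxsub (J t) (J t) Omega.
have ptr_omega : ptrace2 omega = rho.
  apply/matrixP => i j.
  case: (mxtens_indexP i) => a b; case: (mxtens_indexP j) => c d.
  rewrite mxE; under eq_bigr do rewrite summxE.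
  (* The sum over [t] is split into $(a', b')$ and $e'$, so that $e'$ can later join $e$ to form the
     trace over $EE'$. *)
  rewrite exchange_big /= -(pair_bigA _ (fun p e' => \sum_e
    mxsub (J (p, e')) (J (p, e')) Omega (mxtens_index (mxtens_index (a, b), e))
       (mxtens_index (mxtens_index (c, d), e)))) /=.
  (* The factor 1 is expanded as the trace of [sigma], to match both sides for each $(a', b')$. *)
  rewrite -[RHS]mulr1 -tr_sigma /mxtrace mulr_sumr.
  rewrite [RHS]sum_mxtens_index.
  apply: eq_bigr => -[a' b'] _.
  (* At this entry, diagonal in $A'B'$, the regrouped tensor product is an entry of [rho] times a
     diagonal entry of [sigma]. *)
  move/matrixP: ptrO => /(_
    (mxtens_index (mxtens_index (a, a'), mxtens_index (b, b')))
    (mxtens_index (mxtens_index (c, a'), mxtens_index (d, b')))).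
  rewrite !mxE !regroup_indexE !mxtens_indexK /= => <-.
  rewrite [RHS]sum_mxtens_index.
  rewrite exchange_big pair_bigA /=.
  by apply: eq_bigr => -[e e'] _; rewrite mxE !JE.
exists omega; split => //.
- split; last by rewrite -mxtrace_ptrace2 ptr_omega.
  by apply: psdmx_sum => t; apply: psdmx_mxsub.
- rewrite swap23_conjE; apply/matrixP => i j; rewrite mxE !summxE.
  (* After reindexing by [flip], the terms agree one by one through [J_swap] and the invariance of
     [Omega]. *)
  rewrite [RHS](reindex_inj (inv_inj flipK)).
  apply: eq_bigr => t _; rewrite !mxE !J_swap.
  by rewrite -[in RHS]swapO swap23_conjE mxE.
Qed.

End States.

Theorem mainTheorem2 (R : realType) (N M : nat) (rhoAB : 'M[R[i]]_(N * M))
    (rhoAB_state : is_state rhoAB)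
    (rhoAB_not_ext : ~ symmetrically_extendible rhoAB) :
  ~ exists (K L : nat) (rhoA'B' : 'M[R[i]]_(K * L)),
      is_state rhoA'B' /\
      symmetrically_extendible (regroup (tensmx rhoAB rhoA'B')).
Proof.
move=> [K [L [rhoA'B' [[_ tr_rhoA'B'] ext]]]]; apply: rhoAB_not_ext.
case: rhoAB_state => _ tr_rhoAB.
exact: symmetrically_extendible_tensl tr_rhoAB tr_rhoA'B' ext.
Qed.
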